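(* For every $\theta\in[\frac{5\pi}{6},\pi]$, the representation $\rho_\theta: G\to \mathbf{PU}(3,1)$ defined by $\rho_\theta(\iota_i)=I_i$ for $i=1,2,3,4$ is discrete and faithful (that is, $\rho_\theta$ is injective and its image is a discrete subgroup of $\mathbf{PU}(3,1)$).
   Context: $G$ is the abstract group $G=\langle \iota_1,\iota_2,\iota_3,\iota_4 \mid \iota_1^2=\iota_2^2=\iota_3^2=\iota_4^2=(\iota_1\iota_3)^2=(\iota_2\iota_4)^2=id\rangle$. Let $\mathbb{C}^{3,1}$ be $\mathbb{C}^4$ with the Hermitian form $\langle z,w\rangle=w^*Hz$, $H=\mathrm{diag}(1,1,1,-1)$. Let $\mathbf{U}(3,1)$ be the group of complex linear maps preserving this form and $\mathbf{PU}(3,1)$ its quotient by scalar matrices. Complex hyperbolic space ${\bf H}^3_{\mathbb C}$ is the set of points of $\mathbb{CP}^3$ represented by vectors $z$ with $\langle z,z\rangle<0$; $\mathbf{PU}(3,1)$ is its holomorphic isometry group. For $\theta\in[\frac{5\pi}{6},\pi]$ put $$n_1=\tfrac12\left(\sqrt{1-2\cos\theta},\ \sqrt{1-2\sin\theta},\ \sqrt{1+2\sin\theta},\ \sqrt{-1-2\cos\theta}\right)^t,\qquad J=\mathrm{diag}(-1,\mathrm{i},-\mathrm{i},1),$$ and $n_i=J^{i-1}n_1$ for $i=1,2,3,4$. Then $\langle n_i,n_i\rangle=1$, $\langle n_1,n_3\rangle=\langle n_2,n_4\rangle=0$, and $\langle n_i,n_{i+1}\rangle=e^{\theta\mathrm{i}}$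 (indices mod $4$). Let $I_i(z)=-z+2\langle z,n_i\rangle n_i$, an element of $\mathbf{U}(3,1)$; its class in $\mathbf{PU}(3,1)$, also denoted $I_i$, is the order-two complex reflection whose mirror is the complex hyperbolic plane $\{[z]\in{\bf H}^3_{\mathbb C}:\langle z,n_i\rangle=0\}$. The assignment $\iota_i\mapsto I_i$ defines a homomorphism $\rho_\theta:G\to\mathbf{PU}(3,1)$, and $I_iI_{i+1}$ is parabolic for $i=1,2,3,4$ mod $4$. *)

(* Defs.v *)
From HB Require Import structures.
From mathcomp Require Import all_boot all_order all_algebra.
From mathcomp Require Import generic_quotient complex ring lra.
From mathcomp Require Import all_classical all_reals topology normedtype trigo.

Set Implicit Arguments.
Unset Strict Implicit.
Unset Printing Implicit Defensive.

Import Order.TTheory GRing.Theory Num.Theory.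
Import numFieldNormedType.Exports.

Local Open Scope classical_set_scope.
Local Open Scope ring_scope.
Local Open Scope quotient_scope.

(* The topology induced on A by T is discrete. *)
Definition discrete_set (T : topologicalType) (A : set T) : Prop :=
  A `<=` isolated A.

(* A letter [(x, true)] stands for the generator [x], and [(x, false)] for its
   inverse.  The group <X | rels> is the set of words modulo the congruence
   generated by free cancellation and [r = 1] for every [r] in [rels]. *)
Section Presentation.
Variable X : choiceType.

Definition word := seq (X * bool).

HB.instance Definition _ := Choice.on word.

Inductive pres_eq (rels : seq word) : word -> word -> Prop :=
| pres_eq_refl u : pres_eq rels u u
| pres_eq_sym u v : pres_eq rels u v -> pres_eq rels v u
| pres_eq_trans u v w : pres_eq rels u v -> pres_eq rels v w -> pres_eq rels u w
| pres_eq_cancel u v x b :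
    pres_eq rels (u ++ [:: (x, b); (x, ~~ b)] ++ v) (u ++ v)
| pres_eq_rel u v r : r \in rels -> pres_eq rels (u ++ r ++ v) (u ++ v).

Variable rels : seq word.

Definition pres_eqb : rel word := fun u v => `[< pres_eq rels u v >].

Lemma pres_eqb_refl : reflexive pres_eqb.
Proof. by move=> u; apply/asboolP; exact: pres_eq_refl. Qed.

Lemma pres_eqb_sym : symmetric pres_eqb.
Proof. by move=> u v; apply/asboolP/asboolP; exact: pres_eq_sym. Qed.

Lemma pres_eqb_trans : transitive pres_eqb.
Proof.
by move=> v u w /asboolP uv /asboolP vw; apply/asboolP; exact: pres_eq_trans vw.
Qed.

Canonical pres_equiv :=
  EquivRel pres_eqb pres_eqb_refl pres_eqb_sym pres_eqb_trans.

Definition pres_group : Type := {eq_quot pres_equiv}.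

HB.instance Definition _ := Choice.on pres_group.
HB.instance Definition _ := Quotient.on pres_group.

Lemma pres_piP (u v : word) :
  \pi_pres_group u = \pi_pres_group v <-> pres_eq rels u v.
Proof.
split=> [|uv]; first by move=> /eqmodP /asboolP.
by apply/eqmodP/asboolP.
Qed.

Lemma pres_eq_cat u u' v v' :
  pres_eq rels u u' -> pres_eq rels v v' -> pres_eq rels (u ++ v) (u' ++ v').
Proof.
move=> uu' vv'; apply: (@pres_eq_trans _ _ (u' ++ v)).
  elim: uu' {vv'} => {u u'} [u|u w _ ih|u w z _ ih1 _ ih2|u w x b|u w r rr].
  - exact: pres_eq_refl.
  - exact: pres_eq_sym.
  - exact: pres_eq_trans ih2.
  - rewrite -!catA; exact: pres_eq_cancel.
  - rewrite -!catA; exact: pres_eq_rel.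
elim: vv' {uu'} => {v v'} [v|v w _ ih|v w z _ ih1 _ ih2|v w x b|v w r rr].
- exact: pres_eq_refl.
- exact: pres_eq_sym.
- exact: pres_eq_trans ih2.
- rewrite !(catA u'); exact: pres_eq_cancel.
- rewrite !(catA u'); exact: pres_eq_rel.
Qed.

Definition word_inv (u : word) : word := rev [seq (a.1, ~~ a.2) | a <- u].

Lemma word_invK : involutive word_inv.
Proof.
move=> u; rewrite /word_inv map_rev revK -map_comp -[RHS]map_id.
by apply: eq_map => -[x b] /=; rewrite negbK.
Qed.

Lemma word_inv_cons a u : word_inv (a :: u) = word_inv u ++ [:: (a.1, ~~ a.2)].
Proof. by rewrite /word_inv /= rev_cons cats1. Qed.

Lemma word_mulV u : pres_eq rels (u ++ word_inv u) [::].
Proof.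
elim: u => [|[x b] u ih]; first exact: pres_eq_refl.
rewrite word_inv_cons /=.
apply: (@pres_eq_trans _ _ [:: (x, b); (x, ~~ b)]); last first.
  exact: (@pres_eq_cancel _ [::] [::]).
have -> : (x, b) :: u ++ word_inv u ++ [:: (x, ~~ b)] =
  [:: (x, b)] ++ ((u ++ word_inv u) ++ [:: (x, ~~ b)]) by rewrite -catA.
apply: (pres_eq_cat (u' := [:: (x, b)])); first exact: pres_eq_refl.
exact: (pres_eq_cat (u' := [::])) ih (pres_eq_refl _ _).
Qed.

Lemma word_Vmul u : pres_eq rels (word_inv u ++ u) [::].
Proof. by have := word_mulV (word_inv u); rewrite word_invK. Qed.

Lemma pres_eq_inv u v : pres_eq rels u v -> pres_eq rels (word_inv u) (word_inv v).
Proof.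
move=> uv; apply: (@pres_eq_trans _ _ (word_inv u ++ (v ++ word_inv v))).
  apply: pres_eq_sym; rewrite -[X in pres_eq _ _ X]cats0.
  apply: pres_eq_cat; [exact: pres_eq_refl | exact: word_mulV].
rewrite catA; apply: (pres_eq_cat (u' := [::])); last exact: pres_eq_refl.
apply: pres_eq_trans (word_Vmul u).
by apply: pres_eq_cat; [exact: pres_eq_refl | exact: pres_eq_sym].
Qed.

Definition pres_one : pres_group := \pi_pres_group [::].
Definition pres_mul (g h : pres_group) : pres_group := \pi_pres_group (repr g ++ repr h).
Definition pres_inv (g : pres_group) : pres_group := \pi_pres_group (word_inv (repr g)).

Lemma pres_repr u : pres_eq rels (repr (\pi_pres_group u)) u.
Proof. by apply/pres_piP; rewrite reprK. Qed.

Lemma pres_mulE u v : pres_mul (\pi_pres_group u) (\pi_pres_group v) = \pi_pres_group (u ++ v).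
Proof. by apply/pres_piP/pres_eq_cat; exact: pres_repr. Qed.

Lemma pres_invE u : pres_inv (\pi_pres_group u) = \pi_pres_group (word_inv u).
Proof. by apply/pres_piP/pres_eq_inv; exact: pres_repr. Qed.

Lemma pres_mulA : associative pres_mul.
Proof.
elim/quotW=> u; elim/quotW=> v; elim/quotW=> w.
by rewrite (pres_mulE v w) (pres_mulE u v) !pres_mulE catA.
Qed.

Lemma pres_mul1 : left_id pres_one pres_mul.
Proof. by elim/quotW=> u; rewrite pres_mulE. Qed.

Lemma pres_mulr1 : right_id pres_one pres_mul.
Proof. by elim/quotW=> u; rewrite pres_mulE cats0. Qed.

Lemma pres_mulVg : left_inverse pres_one pres_inv pres_mul.
Proof.
by elim/quotW=> u; rewrite pres_invE pres_mulE; apply/pres_piP/word_Vmul.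
Qed.

Lemma pres_mulgV : right_inverse pres_one pres_inv pres_mul.
Proof.
by elim/quotW=> u; rewrite pres_invE pres_mulE; apply/pres_piP/word_mulV.
Qed.

HB.instance Definition _ := isGroup.Build pres_group
  pres_mulA pres_mul1 pres_mulr1 pres_mulVg pres_mulgV.

Definition pres_gen (x : X) : pres_group := \pi_pres_group [:: (x, true)].

Section Lift.
Variables (K : groupType) (f : X -> K).

Fixpoint word_eval (u : word) : K :=
  if u is (x, b) :: u' then ((if b then f x else (f x)^-1) * word_eval u')%g
  else 1%g.

Lemma word_eval_cat u v : word_eval (u ++ v) = (word_eval u * word_eval v)%g.
Proof.
by elim: u => [|[x b] u ih] /=; rewrite ?mul1g // ih mulgA.
Qed.

Hypothesis f_rels : forall r, r \in rels -> word_eval r = 1%g.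

Lemma word_eval_pres u v : pres_eq rels u v -> word_eval u = word_eval v.
Proof.
elim=> {u v} [//|//|u v w _ -> _ -> //|u v x b|u v r rr].
  by rewrite !word_eval_cat; case: b => /=; rewrite mulg1 ?mulgV ?mulVg mul1g.
by rewrite !word_eval_cat (f_rels rr) mul1g.
Qed.

Definition pres_lift_of of (forall r, r \in rels -> word_eval r = 1%g) :=
  fun g : pres_group => word_eval (repr g).

Definition pres_lift := pres_lift_of f_rels.

Lemma pres_liftE u : pres_lift (\pi_pres_group u) = word_eval u.
Proof. by apply: word_eval_pres; exact: pres_repr. Qed.

Lemma pres_liftM : {morph pres_lift : g h / (g * h)%g}.
Proof.
elim/quotW=> u; elim/quotW=> v; rewrite [(_ * _)%g]pres_mulE.
by rewrite !pres_liftE word_eval_cat.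
Qed.

HB.instance Definition _ := isMultiplicative.Build _ _ pres_lift pres_liftM.

Lemma pres_lift_gen x : pres_lift (pres_gen x) = f x.
Proof. by rewrite pres_liftE /= mulg1. Qed.

End Lift.
End Presentation.

(* The generators iota_1, ..., iota_4 are indexed by 0, ..., 3 : 'I_4, as are
   the vectors n_i and the reflections I_i below. *)
Definition G_rels : seq (word 'I_4) :=
  let a (i : 'I_4) := (i, true) in
  [:: [:: a 0; a 0]; [:: a 1; a 1]; [:: a 2; a 2]; [:: a 3; a 3];
      [:: a 0; a 2; a 0; a 2]; [:: a 1; a 3; a 1; a 3] ].

Definition G : groupType := pres_group G_rels.
Definition iota_ (i : 'I_4) : G := pres_gen G_rels i.

(* The product topology of C = R^2, which is that of its modulus. *)
HB.instance Definition _ (R : realType) := PseudoPointedMetric.copy R[i] (R[i])^o.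

Section U31.
Variable R : realType.
Local Notation C := R[i].

Definition adj m n (A : 'M[C]_(m, n)) : 'M[C]_(n, m) := map_mx Num.conj A^T.

Definition Hmx : 'M[C]_4 := diag_mx (\row_(k < 4) [:: 1; 1; 1; -1]`_k).

Definition herm (z w : 'cV[C]_4) : C := (adj w *m Hmx *m z) 0 0.

Definition preserves_herm : pred 'M[C]_4 :=
  fun A => `[< forall z w, herm (A *m z) (A *m w) = herm z w >].

Lemma adjM m n p (A : 'M[C]_(m, n)) (B : 'M[C]_(n, p)) :
  adj (A *m B) = adj B *m adj A.
Proof. by rewrite /adj trmx_mul map_mxM. Qed.

Lemma adjK m n : cancel (@adj m n) (@adj n m).
Proof. by move=> A; apply/matrixP => i j; rewrite !mxE conjCK. Qed.

Lemma adjD m n (A B : 'M[C]_(m, n)) : adj (A + B) = adj A + adj B.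
Proof. by rewrite /adj linearD map_mxD. Qed.

Lemma adjZ m n c (A : 'M[C]_(m, n)) : adj (c *: A) = c^* *: adj A.
Proof. by rewrite /adj linearZ map_mxZ. Qed.

Lemma adjH : adj Hmx = Hmx.
Proof.
apply/matrixP => i j; rewrite !mxE eq_sym; case: eqP => [->|_]; last first.
  by rewrite !mulr0n rmorph0.
by rewrite !mulr1n; case: j => -[|[|[|[|//]]]] ? /=; rewrite ?rmorphN rmorph1.
Qed.

Lemma HH : Hmx *m Hmx = 1%:M.
Proof.
rewrite mulmx_diag; apply/matrixP => i j; rewrite !mxE; congr (_ *+ _).
by case: i => -[|[|[|[|//]]]] ? /=; rewrite ?mulr1 // mulrNN mulr1.
Qed.

Lemma preserves_hermP A : reflect (adj A *m Hmx *m A = Hmx) (preserves_herm A).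
Proof.
apply: (iffP (asboolP _)) => [AP|AH z w]; last first.
  by rewrite /herm adjM !mulmxA -(mulmxA _ (adj A)) -(mulmxA _ (_ *m _)) AH.
apply/matrixP => i j.
have := AP (delta_mx j 0) (delta_mx i 0); rewrite /herm adjM => e.
have adjd : adj (delta_mx i 0 : 'cV_4) = delta_mx 0 i.
  by rewrite /adj trmx_delta map_delta_mx.
have coef (M : 'M[C]_4) :
    ((delta_mx 0 i : 'rV_4) *m M *m (delta_mx j 0 : 'cV_4)) 0 0 = M i j.
  by rewrite -rowE -colE !mxE.
by rewrite -[LHS]coef -[RHS]coef -adjd -e !mulmxA.
Qed.

Record U31 : Type := MkU31 { u31_mx :> 'M[C]_4; _ : preserves_herm u31_mx }.

HB.instance Definition _ := [isSub for u31_mx].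
HB.instance Definition _ := [Choice of U31 by <:].
HB.instance Definition _ := Topological.copy U31 (initial_topology u31_mx).

Lemma U31P (A : U31) : adj A *m Hmx *m A = Hmx.
Proof. by apply/preserves_hermP; case: A. Qed.

Lemma one_preserves : preserves_herm 1%:M.
Proof. by apply/asboolP => z w; rewrite !mul1mx. Qed.

Lemma mul_preserves (A B : U31) : preserves_herm (A *m B).
Proof.
by apply/preserves_hermP; rewrite adjM !mulmxA -(mulmxA _ (adj A))
   -(mulmxA _ (_ *m _)) U31P U31P.
Qed.

Lemma U31_mulVmx (A : U31) : (Hmx *m adj A *m Hmx) *m A = 1%:M.
Proof. by rewrite -!mulmxA (mulmxA (adj A)) U31P HH. Qed.

Lemma U31_mulmxV (A : U31) : A *m (Hmx *m adj A *m Hmx) = 1%:M.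
Proof. exact: mulmx1C (U31_mulVmx A). Qed.

Lemma inv_preserves (A : U31) : preserves_herm (Hmx *m adj A *m Hmx).
Proof.
apply/preserves_hermP; set B := Hmx *m adj A *m Hmx.
have -> : adj B = Hmx *m A *m Hmx by rewrite !adjM adjK adjH mulmxA.
rewrite -(mulmxA (Hmx *m A) Hmx Hmx) HH mulmx1 -(mulmxA Hmx (u31_mx A) B).
by rewrite /B U31_mulmxV mulmx1.
Qed.

Definition U31_one := MkU31 one_preserves.
Definition U31_mul (A B : U31) := MkU31 (mul_preserves A B).
Definition U31_inv (A : U31) := MkU31 (inv_preserves A).

Lemma U31_mulA : associative U31_mul.
Proof. by move=> A B D; apply/val_inj; rewrite /= mulmxA. Qed.

Lemma U31_mul1 : left_id U31_one U31_mul.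
Proof. by move=> A; apply/val_inj; rewrite /= mul1mx. Qed.

Lemma U31_mulr1 : right_id U31_one U31_mul.
Proof. by move=> A; apply/val_inj; rewrite /= mulmx1. Qed.

Lemma U31_mulVg : left_inverse U31_one U31_inv U31_mul.
Proof. by move=> A; apply/val_inj; exact: U31_mulVmx. Qed.

Lemma U31_mulgV : right_inverse U31_one U31_inv U31_mul.
Proof. by move=> A; apply/val_inj; exact: U31_mulmxV. Qed.

HB.instance Definition _ := isGroup.Build U31
  U31_mulA U31_mul1 U31_mulr1 U31_mulVg U31_mulgV.

Definition scal_eqb : rel U31 :=
  fun A B => `[< exists c : C, u31_mx A = c%:M *m u31_mx B >].

Lemma scal_eqb_refl : reflexive scal_eqb.
Proof. by move=> A; apply/asboolP; exists 1; rewrite mul1mx. Qed.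

Lemma U31_neq0 (A : U31) : u31_mx A != 0.
Proof.
apply/eqP => A0; have := U31_mulVmx A; rewrite A0 mulmx0 => /matrixP/(_ 0 0).
by rewrite !mxE /= => /esym/eqP; rewrite oner_eq0.
Qed.

Lemma scal_eqb_sym : symmetric scal_eqb.
Proof.
suff sym A B : scal_eqb A B -> scal_eqb B A by move=> A B; apply/idP/idP; exact: sym.
move=> /asboolP[c e]; apply/asboolP; exists c^-1.
have c0 : c != 0.
  by apply: contraNneq (U31_neq0 A) => c0; rewrite e c0 mul_scalar_mx scale0r.
by rewrite e !mul_scalar_mx scalerA mulVf // scale1r.
Qed.

Lemma scal_eqb_trans : transitive scal_eqb.
Proof.
move=> B A D /asboolP[c e] /asboolP[d e']; apply/asboolP; exists (c * d).
by rewrite e e' !mul_scalar_mx scalerA.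
Qed.

Canonical scal_equiv :=
  EquivRel scal_eqb scal_eqb_refl scal_eqb_sym scal_eqb_trans.

Definition PU31 : Type := quotient_topology {eq_quot scal_equiv}.

HB.instance Definition _ := Topological.on PU31.
HB.instance Definition _ := Quotient.on PU31.

Lemma PU31_piP (A B : U31) : \pi_PU31 A = \pi_PU31 B <->
  exists c : C, u31_mx A = c%:M *m u31_mx B.
Proof.
split; first by move=> /(@eqmodP _ scal_equiv)/asboolP.
by move=> ?; apply/(@eqmodP _ scal_equiv)/asboolP.
Qed.

Definition PU31_one : PU31 := \pi_PU31 (1%g : U31).
Definition PU31_mul (g h : PU31) : PU31 := \pi_PU31 (repr g * repr h)%g.
Definition PU31_inv (g : PU31) : PU31 := \pi_PU31 ((repr g)^-1)%g.

Lemma PU31_repr A : exists c : C, u31_mx (repr (\pi_PU31 A)) = c%:M *m u31_mx A.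
Proof. by apply/PU31_piP; rewrite reprK. Qed.

Lemma PU31_mulE A B : PU31_mul (\pi_PU31 A) (\pi_PU31 B) = \pi_PU31 (A * B)%g.
Proof.
apply/PU31_piP; have [c ec] := PU31_repr A; have [d ed] := PU31_repr B.
exists (c * d); rewrite /= ec ed !mul_scalar_mx.
by rewrite -scalemxAl -scalemxAr scalerA.
Qed.

Lemma PU31_invE A : PU31_inv (\pi_PU31 A) = \pi_PU31 (A^-1)%g.
Proof.
apply/PU31_piP; have [c ec] := PU31_repr A.
exists c^*; rewrite /= ec !mul_scalar_mx adjZ.
by rewrite -!scalemxAr -!scalemxAl.
Qed.

Lemma PU31_mulA : associative PU31_mul.
Proof.
elim/quotW=> A; elim/quotW=> B; elim/quotW=> D.
by rewrite (PU31_mulE B D) (PU31_mulE A B) !PU31_mulE mulgA.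
Qed.

Lemma PU31_mul1 : left_id PU31_one PU31_mul.
Proof. by elim/quotW=> A; rewrite PU31_mulE mul1g. Qed.

Lemma PU31_mulr1 : right_id PU31_one PU31_mul.
Proof. by elim/quotW=> A; rewrite PU31_mulE mulg1. Qed.

Lemma PU31_mulVg : left_inverse PU31_one PU31_inv PU31_mul.
Proof. by elim/quotW=> A; rewrite PU31_invE PU31_mulE mulVg. Qed.

Lemma PU31_mulgV : right_inverse PU31_one PU31_inv PU31_mul.
Proof. by elim/quotW=> A; rewrite PU31_invE PU31_mulE mulgV. Qed.

HB.instance Definition _ := isGroup.Build PU31
  PU31_mulA PU31_mul1 PU31_mulr1 PU31_mulVg PU31_mulgV.

End U31.

Section Representation.
Variable R : realType.
Local Notation C := R[i].
Implicit Type theta : R.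

Definition n1 theta : 'cV[C]_4 := \col_(k < 4)
  real_complex R ([:: Num.sqrt (1 - 2 * cos theta); Num.sqrt (1 - 2 * sin theta);
    Num.sqrt (1 + 2 * sin theta); Num.sqrt (- 1 - 2 * cos theta)]`_k / 2).

Definition Jmx : 'M[C]_4 := diag_mx (\row_(k < 4) [:: -1; 'i%C; - 'i%C; 1]`_k).

Definition nvec theta (i : 'I_4) : 'cV[C]_4 := Jmx ^+ i *m n1 theta.

(* The matrix of z |-> - z + 2 <z, n> n; see refl_mxE. *)
Definition refl_mx (n : 'cV[C]_4) : 'M[C]_4 :=
  - 1%:M + 2 *: (n *m adj n *m Hmx R).

Lemma refl_mxE n z : refl_mx n *m z = - z + (2 * herm z n) *: n.
Proof.
rewrite /refl_mx mulmxDl mulNmx mul1mx -scalemxAl -!mulmxA; congr (_ + _).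
rewrite -scalerA; congr (_ *: _).
rewrite (mulmxA (adj n)) [X in _ *m X]mx11_scalar mul_mx_scalar; congr (_ *: _).
Qed.

Lemma hermZl c (z w : 'cV[C]_4) : herm (c *: z) w = c * herm z w.
Proof. by rewrite /herm -scalemxAr mxE. Qed.

Lemma hermDl (z z' w : 'cV[C]_4) : herm (z + z') w = herm z w + herm z' w.
Proof. by rewrite /herm mulmxDr mxE. Qed.

Lemma herm_sym (z w : 'cV[C]_4) : herm z w = (herm w z)^*.
Proof.
rewrite /herm -[RHS](_ : (adj (adj z *m Hmx R *m w)) 0 0 = _); last by rewrite !mxE.
by rewrite !adjM adjK adjH mulmxA.
Qed.

Lemma hermZr c (z w : 'cV[C]_4) : herm z (c *: w) = c^* * herm z w.
Proof. by rewrite herm_sym hermZl rmorphM (herm_sym z w). Qed.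

Lemma hermDr (z w w' : 'cV[C]_4) : herm z (w + w') = herm z w + herm z w'.
Proof. by rewrite herm_sym hermDl rmorphD (herm_sym z w) (herm_sym z w'). Qed.

Lemma hermE (z w : 'cV[C]_4) : herm z w =
  (w 0 0)^* * z 0 0 + (w 1 0)^* * z 1 0 + (w 2 0)^* * z 2 0 - (w 3 0)^* * z 3 0.
Proof.
rewrite /herm mul_mx_diag mxE !big_ord_recl big_ord0 !mxE /= addr0 !mulr1 mulrN1.
rewrite mulNr !addrA.
by do ![congr (_ + _)]; rewrite ?mulNr //;
  do ?[congr (- _)]; congr (_ ^* * _); congr (_ _ _); apply/val_inj.
Qed.

Lemma refl_preserves (n : 'cV[C]_4) : herm n n = 1 -> preserves_herm (refl_mx n).
Proof.
move=> nn; apply/asboolP => z w; rewrite !refl_mxE -[- z]scaleN1r -[- w]scaleN1r.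
rewrite !(hermDl, hermDr, hermZl, hermZr) nn (herm_sym n w) !rmorphM rmorphN rmorph1.
by rewrite rmorph_nat; ring.
Qed.

Lemma refl_mxK (n : 'cV[C]_4) : herm n n = 1 -> refl_mx n *m refl_mx n = 1%:M.
Proof.
move=> nn; rewrite /refl_mx; set P := n *m _ *m _.
have PP : P *m P = P.
  rewrite /P -!mulmxA (mulmxA (Hmx R) n) (mulmxA (adj n)) (mulmxA (adj n)).
  by rewrite [adj n *m _ *m n]mx11_scalar -/(herm n n) nn mul1mx.
rewrite mulmxDl !mulmxDr !mulNmx !mulmxN !mul1mx !mulmx1.
rewrite -!scalemxAl -!scalemxAr PP scalerA opprK -addrA -[RHS]addr0; congr (_ + _).
by rewrite -!scaleNr -!scalerDl [X in X *: _](_ : _ = 0) ?scale0r //; ring.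
Qed.

Lemma refl_mxC (n m : 'cV[C]_4) : herm n m = 0 ->
  refl_mx n *m refl_mx m = refl_mx m *m refl_mx n.
Proof.
have proj0 (u v : 'cV[C]_4) : herm v u = 0 ->
    (u *m adj u *m Hmx R) *m (v *m adj v *m Hmx R) = 0.
  move=> vu; rewrite -!mulmxA (mulmxA (Hmx R) v) (mulmxA (adj u)) (mulmxA (adj u)).
  by rewrite [adj u *m _ *m v]mx11_scalar -/(herm v u) vu mul_scalar_mx scale0r mulmx0.
have comm (P Q : 'M[C]_4) : P *m Q = 0 -> Q *m P = 0 ->
    (- 1%:M + 2 *: P) *m (- 1%:M + 2 *: Q) = (- 1%:M + 2 *: Q) *m (- 1%:M + 2 *: P).
  move=> PQ QP; rewrite !mulmxDl !mulmxDr !mulNmx !mulmxN !mul1mx !mulmx1.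
  by rewrite -!scalemxAl -!scalemxAr PQ QP !scaler0 !addr0 addrAC.
move=> nm; have mn : herm m n = 0 by rewrite herm_sym nm rmorph0.
by apply: comm; exact: proj0.
Qed.

Lemma mul_ii : 'i%C * 'i%C = -1 :> C.
Proof. by apply/eqP; rewrite eq_complex /=; apply/andP; split; apply/eqP; ring. Qed.

Lemma conjCi : ('i%C : C)^* = - 'i%C.
Proof. by apply/eqP; rewrite eq_complex /=; apply/andP; split; apply/eqP; ring. Qed.

Lemma Jmx_preserves : preserves_herm Jmx.
Proof.
apply/asboolP => z w; rewrite !hermE !mul_diag_mx !mxE /=.
have cM (a b : C) : (a * b)^* = a^* * b^* by exact: rmorphM.
have cN (a : C) : (- a)^* = - a^* by exact: rmorphN.
have c1 : (1 : C)^* = 1 by exact: rmorph1.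
rewrite !(cM, cN, c1, conjCi).
have -> (a b : C) : - 'i%C * a * ('i%C * b) = a * b.
  by rewrite mulrACA mulNr mul_ii opprK mul1r.
have -> (a b : C) : - - 'i%C * a * (- 'i%C * b) = a * b.
  by rewrite opprK mulrACA mulrN mul_ii opprK mul1r.
by rewrite !mul1r !mulN1r mulrNN.
Qed.

Lemma JmxP (z w : 'cV[C]_4) : herm (Jmx *m z) (Jmx *m w) = herm z w.
Proof. by move/asboolP: Jmx_preserves; apply. Qed.

Lemma herm_Jexp k (z w : 'cV[C]_4) : herm (Jmx ^+ k *m z) (Jmx ^+ k *m w) = herm z w.
Proof.
elim: k => [|k ih]; first by rewrite expr0 !mul1mx.
by rewrite exprS -!mulmxA JmxP.
Qed.

Section Angle.
Variables (theta : R) (theta_itv : 5 * pi / 6 <= theta <= pi).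

Lemma sin_pi6 : sin (pi / 6 : R) = 1 / 2.
Proof.
have p0 := @pi_gt0 R.
have s0 : 0 < sin (pi / 6 : R) by apply: sin_gt0_pi; apply/andP; split; lra.
have : cos ((pi / 6) *+ 2) = sin (pi / 6 : R).
  rewrite -[cos _]opprK -sinBpihalf -sinN; congr sin; by field.
rewrite cos_mulr2n cos2sin2; set s := sin _ => e.
have /eqP : (2 * s - 1) * (s + 1) = 0 by rewrite mulrDr; move: e; rewrite mulr2n; lra.
by rewrite mulf_eq0 => /orP[]/eqP; rewrite -/s in s0 *; lra.
Qed.

Lemma sin_theta_ge0 : 0 <= sin theta.
Proof.
apply: sin_ge0_pi; have := @pi_gt0 R; case/andP: theta_itv; lra.
Qed.

Lemma sin_theta_le : sin theta <= 1 / 2.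
Proof.
have p0 := @pi_gt0 R; case/andP: theta_itv => h1 h2.
have -> : sin theta = sin (pi - theta) by rewrite sinB sinpi cospi; ring.
rewrite -sin_pi6 leNgt ltr_sin -?leNgt; first by lra.
all: by rewrite in_itv /=; apply/andP; split; lra.
Qed.

Lemma cos_theta_le : cos theta <= - (1 / 2).
Proof.
have c0 : cos theta <= 0.
  have p0 := @pi_gt0 R; case/andP: theta_itv => h1 h2.
  rewrite -[cos _]opprK -sinBpihalf oppr_le0.
  by apply: sin_ge0_pi; apply/andP; split; lra.
have := cos2Dsin2 theta; have := sin_theta_ge0; have := sin_theta_le; nra.
Qed.

Lemma n1_sqr (k : 'I_4) : (n1 theta k 0)^* * n1 theta k 0 =
  real_complex R ([:: 1 - 2 * cos theta; 1 - 2 * sin theta; 1 + 2 * sin theta;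
    - 1 - 2 * cos theta]`_k / 4).
Proof.
rewrite mxE; set x := _ / 2.
have -> : (real_complex R x)^* = real_complex R x by exact: conjc_real.
rewrite -rmorphM {}/x; congr (real_complex R _).
have := sin_theta_ge0; have := sin_theta_le; have := cos_theta_le => c s s0.
rewrite mulf_div -expr2.
by case: k => -[|[|[|[|//]]]] ? /=; rewrite sqr_sqrtr -?natrM //; lra.
Qed.

Lemma nvec_norm i : herm (nvec theta i) (nvec theta i) = 1.
Proof.
rewrite herm_Jexp hermE !n1_sqr /= -!rmorphD -rmorphB /=.
have -> : (1 : C) = real_complex R 1 by [].
congr (real_complex R _); by field.
Qed.

Lemma JmxE (z : 'cV[C]_4) k : (Jmx *m z) k 0 = [:: -1; 'i%C; - 'i%C; 1]`_k * z k 0.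
Proof. by rewrite mul_diag_mx !mxE. Qed.

Lemma nvec_orth02 : herm (nvec theta 2) (nvec theta 0) = 0.
Proof.
rewrite /nvec expr0 mul1mx -[Jmx ^+ _]/(Jmx *m Jmx) -mulmxA hermE !JmxE /=.
have sw (a x y : C) : x * (a * (a * y)) = (a * a) * (x * y) by ring.
rewrite !sw !n1_sqr mulrNN mulrNN mul_ii !mul1r !mulN1r -!rmorphN -!rmorphD /=.
have -> : (0 : C) = real_complex R 0 by [].
congr (real_complex R _); by field.
Qed.

Lemma nvec_orth13 : herm (nvec theta 3) (nvec theta 1) = 0.
Proof.
have -> : nvec theta 3 = Jmx *m nvec theta 2 by rewrite /nvec mulmxA.
have -> : nvec theta 1 = Jmx *m nvec theta 0 by rewrite /nvec expr0 mul1mx.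
by rewrite JmxP nvec_orth02.
Qed.

Definition I_U31 (i : 'I_4) : U31 R := MkU31 (refl_preserves (nvec_norm i)).

Definition I_ (i : 'I_4) : PU31 R := \pi_(PU31 R) (I_U31 i).

Lemma G_rels_I_ r : r \in G_rels -> word_eval I_ r = 1%g.
Proof.
have sq i : (I_U31 i * I_U31 i)%g = 1%g by apply/val_inj/refl_mxK/nvec_norm.
have cm i j : herm (nvec theta i) (nvec theta j) = 0 ->
    (I_U31 i * I_U31 j * I_U31 i * I_U31 j)%g = 1%g.
  move=> ij; have e : (I_U31 i * I_U31 j = I_U31 j * I_U31 i)%g.
    by apply/val_inj/refl_mxC.
  by rewrite e -(mulgA (I_U31 j)) sq mulg1 sq.
have piM A B : (\pi_(PU31 R) A * \pi_(PU31 R) B)%g = \pi_(PU31 R) (A * B)%g.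
  exact: PU31_mulE.
have o20 : herm (nvec theta 0) (nvec theta 2) = 0.
  by rewrite herm_sym nvec_orth02 rmorph0.
have o31 : herm (nvec theta 1) (nvec theta 3) = 0.
  by rewrite herm_sym nvec_orth13 rmorph0.
have w2 i j : (I_ i * (I_ j * 1))%g = \pi_(PU31 R) (I_U31 i * I_U31 j)%g.
  by rewrite mulg1 /I_ (piM (I_U31 i) (I_U31 j)).
have w4 i j k l : (I_ i * (I_ j * (I_ k * (I_ l * 1))))%g =
    \pi_(PU31 R) (I_U31 i * I_U31 j * I_U31 k * I_U31 l)%g.
  by rewrite w2 /I_ (piM (I_U31 j) _) (piM (I_U31 i) _) !mulgA.
rewrite !inE; do ![case/orP]; move/eqP => -> /=.
- by rewrite w2 sq.
- by rewrite w2 sq.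
- by rewrite w2 sq.
- by rewrite w2 sq.
- by rewrite w4 cm.
- by rewrite w4 cm.
Qed.

Definition rho : {multiplicative G -> PU31 R} := pres_lift G_rels_I_.

Lemma rho_iota i : rho (iota_ i) = I_ i.
Proof. exact: pres_lift_gen. Qed.

End Angle.
End Representation.

(* Main.v *)
Require Import Defs.
From mathcomp Require Import all_boot all_order all_algebra.
From mathcomp Require Import generic_quotient complex ring lra.
From mathcomp Require Import all_classical all_reals topology normedtype trigo.

(** The group [G] is the free product of the four-groups <iota_1, iota_3> and
    <iota_2, iota_4>, and the proof is a ping-pong argument for these two
    subgroups.

    Write u = e^(i theta), z_i = <z, n_i>, and, for neighbouring indices i and
    j, q_ij = n_i - <n_i, n_j> n_j.  As |<n_i, n_j>| = 1, the vector q_ij is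
    null and orthogonal to n_i and n_j: it is the parabolic fixed point of
    I_i I_j.  The ratio z_i / <z, q_ij> is a complex coordinate around this
    cusp in which I_i is the map a |-> - a and I_j is a |-> 2 - a, so that the
    half-planes Re a > 0 and Re a < 1 bound a fundamental domain of <I_i, I_j>.
    Up to a positive factor, Re (z_i / <z, q_ij>) is the Hermitian form
    [slope z n_i n_j].

    The ping-pong domain of <I_1, I_3> is the set of negative vectors on which
    the slopes (1,2), (1,4), (3,2) and (3,4) are positive; that of <I_2, I_4>
    is its image under J.  A nontrivial element of either subgroup maps its own
    domain into the other one ([domain_refl], [domain_refl2]).  For a single
    reflection this follows from [slope_swap], that is, slope_ij + slope_ji >= 0,
    and from [slope_chain], slope_ba + slope_cd > 0 for consecutive indices
    a, b, c, d; for the product of the two reflections it is [slope_refl2].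
    These last two rest on an explicit identity and on one fact about signature
    (3,1), [herm_orth_ge0]: the orthogonal of a nonzero vector of nonpositive
    norm contains no negative vector.

    The centre [0 : 0 : 0 : 1], which J fixes, lies in both domains.
    A nontrivial element of [G] is an alternating product of nontrivial
    elements of the two subgroups, so it sends the centre into the image of a
    domain under such an element; this image avoids an open neighbourhood
    [base_region] of the centre ([base_region_refl], [base_region_refl2]).
    Hence only the identity keeps the centre in the neighbourhood, which gives
    both injectivity and discreteness. *)

Set Implicit Arguments.
Unset Strict Implicit.
Unset Printing Implicit Defensive.

Import Order.TTheory GRing.Theory Num.Theory.
Import numFieldNormedType.Exports.

Local Open Scope classical_set_scope.
Local Open Scope ring_scope.
Local Open Scope quotient_scope.

(** * Indices modulo 4 *)

Section Indices.
Implicit Types i j : 'I_4.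

Lemma ord4_addr2 i : i + 1 + 1 = i + 2.
Proof. by apply/val_inj; case: i => -[|[|[|[|]]]]. Qed.

Lemma ord4_addr3 i : i + 2 + 1 = i - 1.
Proof. by apply/val_inj; case: i => -[|[|[|[|]]]]. Qed.

Lemma ord4_addr4 i : i + 2 + 2 = i.
Proof. by apply/val_inj; case: i => -[|[|[|[|]]]]. Qed.

Lemma ord4_subrD i : i - 1 + 2 = i + 1.
Proof. by apply/val_inj; case: i => -[|[|[|[|]]]]. Qed.

Lemma ord4_odd_addr2 i : odd (i + 2)%R = odd i.
Proof. by case: i => -[|[|[|[|]]]]. Qed.

Lemma ord4_neighbour i j : odd j = ~~ odd i -> j = i + 1 \/ j = i - 1.
Proof.
case: i => -[|[|[|[|//]]]] ?; case: j => -[|[|[|[|//]]]] ? //= _;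
  by [left; apply/val_inj | right; apply/val_inj].
Qed.

Lemma ord4_same_parity i j : odd j = odd i -> j = i \/ j = i + 2.
Proof.
case: i => -[|[|[|[|//]]]] ?; case: j => -[|[|[|[|//]]]] ? //= _;
  by [left; apply/val_inj | right; apply/val_inj].
Qed.

End Indices.

(** * Reflections and slopes in a Lorentzian Hermitian space *)

Section Conjugation.
Variable C : numClosedFieldType.

Lemma conjM (x y : C) : (x * y)^* = x^* * y^*. Proof. exact: rmorphM. Qed.
Lemma conjD (x y : C) : (x + y)^* = x^* + y^*. Proof. exact: rmorphD. Qed.
Lemma conjN (x : C) : (- x)^* = - x^*. Proof. exact: rmorphN. Qed.
Definition conjE := (conjM, conjD, conjN, @conjC0 C, @conjC1 C, @conjC_nat C, @conjCK C).

Lemma conj_cross (x y : C) : (x * y^* + x^* * y)^* = x * y^* + x^* * y.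
Proof. by rewrite !conjE addrC. Qed.

End Conjugation.

(** The form is kept abstract so that the polynomial identities below are checked
    over an arbitrary closed field.  [herm_orth_ge0] is the only property of the
    signature that they are combined with: there is at most one negative
    direction. *)
Section Lorentz.
Variables (C : numClosedFieldType) (V : lmodType C) (herm : V -> V -> C).
Hypotheses
  (hermDl : forall z z' w, herm (z + z') w = herm z w + herm z' w)
  (hermZl : forall c z w, herm (c *: z) w = c * herm z w)
  (herm_sym : forall z w, herm z w = (herm w z)^*)
  (herm_orth_ge0 : forall m z,
    m != 0 -> herm m m <= 0 -> herm z m = 0 -> 0 <= herm z z).
Implicit Types z w n m : V.

Let hermDr z w w' : herm z (w + w') = herm z w + herm z w'.
Proof. by rewrite herm_sym hermDl rmorphD (herm_sym z w) (herm_sym z w'). Qed.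

Let hermZr c z w : herm z (c *: w) = c^* * herm z w.
Proof. by rewrite herm_sym hermZl rmorphM (herm_sym z w). Qed.

Let hermNl z w : herm (- z) w = - herm z w.
Proof. by rewrite -scaleN1r hermZl mulN1r. Qed.

Let hermNr z w : herm z (- w) = - herm z w.
Proof. by rewrite -scaleN1r hermZr !conjE mulN1r. Qed.

Let hermE := (hermDl, hermDr, hermNl, hermNr, hermZl, hermZr).

Definition reflection n z := - z + (2 * herm z n) *: n.

Lemma herm_refl n z w :
  herm (reflection n z) w = - herm z w + 2 * herm z n * herm n w.
Proof. by rewrite !hermE. Qed.

(** When n and m have norm 1 and |<n, m>| = 1, the vector n - <n, m> m is null and
    orthogonal to both: it is the parabolic fixed point of the product of the two
    reflections.  The slope is twice the real part of <z, n> / k times |k|^2, for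
    k the product of z with this null vector. *)
Definition slope z n m : C :=
  let k := herm z (n - herm n m *: m) in
  herm z n * k^* + (herm z n)^* * k.

Lemma slopeE z n m : slope z n m =
  2 * (herm z n)^* * herm z n
  - herm n m * herm z n * (herm z m)^* - (herm n m)^* * (herm z n)^* * herm z m.
Proof. by rewrite /slope !hermE !conjE; ring. Qed.

(** Up to a unit factor n and m share their null vector, and exchanging them
    replaces the ratio a = <z, n> / k by 1 - a. *)
Lemma slope_swap z n m : herm n m * (herm n m)^* = 1 ->
  slope z n m + slope z m n = 2 * `|herm z (n - herm n m *: m)| ^+ 2.
Proof.
move=> g1; rewrite !slopeE (herm_sym m n) normCK !hermE !conjE.
by ring: g1.
Qed.

(** The reflection in n fixes the null vector up to sign and turns the ratio a
    into - a. *)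
Lemma slope_refl z n m : herm n n = 1 -> herm n m * (herm n m)^* = 1 ->
  slope (reflection n z) n m = - slope z n m.
Proof.
by move=> nn g1; rewrite !slopeE !herm_refl nn !conjE; ring: g1.
Qed.

Section Chain.
Variables (u : C) (a b c d : V).
Hypotheses (u1 : u * u^* = 1)
  (aa : herm a a = 1) (bb : herm b b = 1) (cc : herm c c = 1) (dd : herm d d = 1)
  (ab : herm a b = u) (bc : herm b c = u) (cd : herm c d = u) (da : herm d a = u)
  (ac : herm a c = 0) (bd : herm b d = 0).

(** Subtracting from z suitable multiples of d and a gives a vector z' orthogonal
    to the null vector b - u c, hence of nonnegative norm; the multiples are
    chosen so that <z', z'> produces the cross terms of both slopes:
    <z', z'> = <z, z> + slope_ba + slope_cd - |z_b - u^3 z_c|^2. *)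
Lemma slope_chain z : herm z z < 0 -> 0 < slope z b a + slope z c d.
Proof.
move=> zz.
pose q := b - u *: c.
pose z' := z - (u * herm z c) *: d - (u^* * herm z b) *: a.
have ba : herm b a = u^* by rewrite herm_sym ab.
have cb : herm c b = u^* by rewrite herm_sym bc.
have dc : herm d c = u^* by rewrite herm_sym cd.
have ad : herm a d = u^* by rewrite herm_sym da.
have db : herm d b = 0 by rewrite herm_sym bd conjC0.
have q0 : q != 0.
  apply/eqP => q0; have : herm q d = 0 by rewrite q0 -(scale0r a) hermZl mul0r.
  rewrite !hermE bd cd sub0r => /eqP; rewrite oppr_eq0 mulf_eq0 orbb => /eqP u0.
  by move: u1; rewrite u0 mul0r => /esym/eqP; rewrite oner_eq0.
have qq : herm q q = 0.
  by rewrite !hermE bb bc cb cc; ring: u1.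
have zq : herm z' q = 0.
  rewrite !hermE ab ac db dc; ring: u1.
have := herm_orth_ge0 q0 _ zq; rewrite qq lexx => /(_ isT).
have -> : herm z' z' = herm z z + slope z b a + slope z c d
    - `|herm z b - u ^+ 3 * herm z c| ^+ 2.
  rewrite normCK !slopeE !hermE ba cd.
  rewrite aa dd da ad (herm_sym a z) (herm_sym d z) !exprS expr0 !conjE.
  by ring: u1.
rewrite subr_ge0 -addrA => /(le_trans (exprn_ge0 2 (normr_ge0 _))) h.
by rewrite -(ltrD2l (herm z z)) addr0; apply: lt_le_trans h.
Qed.

End Chain.

Section Centre.
Variables (u : C) (o p q : V).
Hypotheses (u1 : u * u^* = 1)
  (oo : herm o o = 1) (pp : herm p p = 1) (qq : herm q q = 1)
  (op : herm o p = u) (qo : herm q o = u) (pq : herm p q = 0).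

Let m := o - u *: p - u^* *: q.

Let po : herm p o = u^*. Proof. by rewrite herm_sym op. Qed.
Let oq : herm o q = u^*. Proof. by rewrite herm_sym qo. Qed.
Let qp : herm q p = 0. Proof. by rewrite herm_sym pq conjC0. Qed.

(** The vector m is the component of o orthogonal to p and q; its norm is
    1 - 1 - 1 = -1.  Removing from z its components along p, q and m leaves a
    vector orthogonal to m, hence of nonnegative norm. *)
Lemma centre_cone z : herm z z < 0 ->
  `|herm z p| ^+ 2 + `|herm z q| ^+ 2 < `|herm z m| ^+ 2.
Proof.
move=> zz.
have mm : herm m m = -1.
  rewrite !hermE oo pp qq op qo pq po oq qp !conjE.
  by ring: u1.
have mp : herm m p = 0.
  by rewrite !hermE op pp qp; ring.
have mq : herm m q = 0.
  by rewrite !hermE oq qq pq; ring.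
have m0 : m != 0.
  apply/eqP => m0; have := mm; rewrite m0 -(scale0r o) hermZl mul0r.
  by move/eqP; rewrite eq_sym oppr_eq0 oner_eq0.
move: m mm mp mq m0 => w mm mp mq w0.
have pw : herm p w = 0 by rewrite herm_sym mp conjC0.
have qw : herm q w = 0 by rewrite herm_sym mq conjC0.
pose z' := z - herm z p *: p - herm z q *: q + herm z w *: w.
have zw : herm z' w = 0.
  by rewrite !hermE mm pw qw; ring.
have := herm_orth_ge0 w0 _ zw; rewrite mm lerN10 => /(_ isT).
have -> : herm z' z' = herm z z - (`|herm z p| ^+ 2 + `|herm z q| ^+ 2)
    + `|herm z w| ^+ 2.
  rewrite /z' !normCK !hermE.
  rewrite mm mp mq pp qq pq qp pw qw (herm_sym p z) (herm_sym q z) (herm_sym w z).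
  by ring.
rewrite -addrA => h; rewrite -subr_gt0 addrC.
by rewrite -(ltrD2l (herm z z)) addr0; apply: lt_le_trans h.
Qed.

(** The phases of <o, p> and <q, o> can be absorbed into z_p and z_q, which become
    - eta and - zeta below.  The claim is then about real quadratic forms in three
    variables: three times the new slope dominates a positive combination of the
    two old slopes and of the form of [centre_cone]. *)
Lemma slope_refl2 z : herm z z < 0 -> 0 < slope z p o -> 0 < slope z q o ->
  0 < slope (reflection p (reflection q z)) o p.
Proof.
move=> /centre_cone cone zp zq; rewrite -(pmulr_rgt0 _ (ltr0n C 3)).
(* The weights 1, 2 and 4 leave a remainder which is a sum of two squares. *)
set eta := u^* * herm z p; set zeta := u * herm z q.
suff -> : 3 * slope (reflection p (reflection q z)) o p =
    slope z p o + 2 * slope z q o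
    + 4 * (`|herm z m| ^+ 2 - (`|herm z p| ^+ 2 + `|herm z q| ^+ 2))
    + 2 * (`|herm z o - 2 * eta - 3 * zeta| ^+ 2 + `|eta + zeta| ^+ 2).
  rewrite ltr_wpDr ?mulr_ge0 ?addr_ge0 ?exprn_ge0 //.
  have zq2 : 0 < 2 * slope z q o by rewrite mulr_gt0.
  have cone4 := mulr_gt0 (ltr0n C 4) (etrans (subr_gt0 _ _) cone).
  exact: addr_gt0 (addr_gt0 zp zq2) cone4.
rewrite !slopeE !normCK !herm_refl !hermE po pp qo qp op.
by rewrite /eta /zeta !conjE; ring: u1.
Qed.

End Centre.

(** The moduli |<z, n>|^2 and the terms in m cancel between z and its image, and
    only the interaction of n with n' survives. *)
Lemma slope_refl2_sum z n n' m : herm n n = 1 -> herm n' n' = 1 -> herm n n' = 0 ->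
  herm n m * (herm n m)^* = 1 -> herm n' m = (herm n m)^* ->
  slope z n m + slope (reflection n (reflection n' z)) n m =
  - 2 * ((herm n m) ^+ 2 * herm z n * (herm z n')^*
         + ((herm n m)^*) ^+ 2 * (herm z n)^* * herm z n').
Proof.
move=> nn nn' o g1 e; have o' : herm n' n = 0 by rewrite herm_sym o conjC0.
rewrite !slopeE !herm_refl nn e o' !conjE; ring: g1.
Qed.


Lemma herm_reflection n z w : herm n n = 1 ->
  herm (reflection n z) (reflection n w) = herm z w.
Proof.
move=> nn; rewrite /reflection !hermE nn (herm_sym n w) !conjE; ring.
Qed.

Lemma reflectionC n m z : herm n m = 0 ->
  reflection n (reflection m z) = reflection m (reflection n z).
Proof.
move=> nm; have mn : herm m n = 0 by rewrite herm_sym nm conjC0.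
rewrite /reflection !hermE nm mn !mulr0 !addr0 !mulrN !scaleNr !opprD !opprK.
by rewrite addrAC.
Qed.

(** * Ping-pong domains *)

Section PingPong.
Variables (u : C) (n : 'I_4 -> V).
Hypotheses (u1 : u * u^* = 1) (u2 : 0 < u ^+ 2 + u^* ^+ 2)
  (n_norm : forall i, herm (n i) (n i) = 1)
  (n_next : forall i, herm (n i) (n (i + 1)) = u)
  (n_opp : forall i, herm (n i) (n (i + 2)) = 0).

Let u1c : u^* * u^*^* = 1. Proof. by rewrite conjCK mulrC. Qed.

Let n_prev i : herm (n i) (n (i - 1)) = u^*.
Proof. by rewrite herm_sym -{2}(subrK 1 i) n_next. Qed.

Let gram i :
  [/\ herm (n (i - 1)) (n i) = u, herm (n (i + 1)) (n (i + 2)) = u,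
      herm (n (i + 2)) (n (i - 1)) = u & herm (n (i - 1)) (n (i + 1)) = 0].
Proof.
split; [rewrite -{2}(subrK 1 i)|rewrite -ord4_addr2|rewrite -ord4_addr3|
  rewrite -ord4_subrD];
  by rewrite ?n_next ?n_opp.
Qed.

Let slope_next i z : herm z z < 0 ->
  0 < slope z (n i) (n (i - 1)) + slope z (n (i + 1)) (n (i + 2)).
Proof.
by have [? ? ? ?] := gram i; apply: (slope_chain u1).
Qed.

Let slope_prev i z : herm z z < 0 ->
  0 < slope z (n i) (n (i + 1)) + slope z (n (i - 1)) (n (i + 2)).
Proof.
have [g1 g2 g3 g4] := gram i; apply: (slope_chain u1c) => //;
  by rewrite herm_sym ?n_next ?g1 ?g2 ?g3 ?g4 ?n_opp ?conjC0.
Qed.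

(** The boolean is the parity of the indices of the subgroup: [domain false]
    belongs to the reflections 0 and 2, and [domain true] to 1 and 3. *)
Definition domain (s : bool) z := herm z z < 0 /\
  forall i : 'I_4, odd i = s ->
    0 < slope z (n i) (n (i + 1)) /\ 0 < slope z (n i) (n (i - 1)).

(** The reflection changes the signs of the two slopes based at n_i.  Each slope
    based at a neighbour of n_i has a nonnegative sum with one of them, by
    [slope_swap] or [slope_chain], so it becomes positive. *)
Lemma domain_refl (i : 'I_4) z :
  domain (odd i) z -> domain (~~ odd i) (reflection (n i) z).
Proof.
move=> [zz zD]; have [si si'] := zD i erefl.
set z' := reflection _ _.
have zz' : herm z' z' < 0 by rewrite herm_reflection.
have e : slope z' (n i) (n (i + 1)) = - slope z (n i) (n (i + 1)).
  by rewrite slope_refl ?n_norm ?n_next.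
have e' : slope z' (n i) (n (i - 1)) = - slope z (n i) (n (i - 1)).
  by rewrite slope_refl ?n_norm ?n_prev.
have gt0 (x y k : C) : x = - y -> 0 < y -> 0 <= x + k -> 0 < k.
  by move=> -> y0; rewrite addrC subr_ge0; apply: lt_le_trans.
have sq0 (k : C) : 0 <= 2 * `|k| ^+ 2 by rewrite mulr_ge0 ?exprn_ge0.
split=> // j /ord4_neighbour[]->.
  rewrite addrK -addrA; split.
    by apply: (gt0 _ _ _ e' si'); apply/ltW/slope_next.
  by apply: (gt0 _ _ _ e si); rewrite slope_swap ?n_next.
rewrite subrK; split.
  by apply: (gt0 _ _ _ e' si'); rewrite slope_swap ?n_prev.
have -> : i - 1 - 1 = i + 2 by rewrite -(ord4_addr3 i) addrK.
by apply: (gt0 _ _ _ e si); apply/ltW/slope_prev.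
Qed.

(** Every neighbour of n_i is also a neighbour of n_(i+2), so it can play the role
    of the centre o in [slope_refl2], with n_i and n_(i+2) as p and q in either
    order. *)
Lemma domain_refl2 (i : 'I_4) z : domain (odd i) z ->
  domain (~~ odd i) (reflection (n i) (reflection (n (i + 2)) z)).
Proof.
move=> [zz zD]; split=> [|j].
  by rewrite !herm_reflection.
have main (k : 'I_4) : odd k = odd i ->
  let z' := reflection (n k) (reflection (n (k + 2)) z) in
  0 < slope z' (n (k + 1)) (n (k + 1 + 1)) /\ 0 < slope z' (n (k + 1)) (n (k + 1 - 1)).
  move=> ki z'; rewrite addrK ord4_addr2.
  have [sk _] := zD k ki.
  have [_ sk2] := zD (k + 2) (etrans (ord4_odd_addr2 k) ki).
  have e1 : k + 2 - 1 = k + 1 by rewrite -ord4_addr2 addrK.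
  rewrite e1 in sk2.
  have [_ g2 _ _] := gram k.
  split; last first.
    apply: (slope_refl2 (u := u^*)) => //; by rewrite ?n_opp // herm_sym ?n_next ?g2.
  rewrite /z' reflectionC ?n_opp //.
  apply: (slope_refl2 u1) => //.
  by rewrite herm_sym n_opp conjC0.
move/ord4_neighbour => []->; first exact: main.
have := main (i + 2) (ord4_odd_addr2 i); rewrite ord4_addr3 ord4_addr4 => /=.
by rewrite (reflectionC z (n_opp i)).
Qed.

(** The common part of the two domains, cut down by Re (z_i / z_(i+2)) > 0: the
    last condition separates it from its images under the products of two
    commuting reflections. *)
Definition base_region z :=
  (forall i : 'I_4, 0 < slope z (n i) (n (i + 1)) /\ 0 < slope z (n i) (n (i - 1))) /\
  (forall i : 'I_4, 0 < herm z (n i) * (herm z (n (i + 2)))^*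
                       + (herm z (n i))^* * herm z (n (i + 2))).

Lemma base_region_refl (i : 'I_4) z :
  domain (odd i) z -> ~ base_region (reflection (n i) z).
Proof.
move=> [_ zD] [b _]; have [si _] := zD i erefl; have [] := b i.
by rewrite slope_refl ?n_norm ?n_next // oppr_gt0 => /(lt_trans si); rewrite ltxx.
Qed.

(** If z and its image z' both had positive slopes based at n_i, the sum of these
    four slopes would be positive; by [slope_refl2_sum] it is - 8 Re (u^2) times
    the real part of z'_i times the conjugate of z'_(i+2), hence negative. *)
Lemma base_region_refl2 (i : 'I_4) z :
  domain (odd i) z -> ~ base_region (reflection (n i) (reflection (n (i + 2)) z)).
Proof.
move=> [_ zD] [b b']; have [si si'] := zD i erefl; have [ti ti'] := b i.
have on : herm (n (i + 2)) (n i) = 0 by rewrite herm_sym n_opp conjC0.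
have [_ g2 g3 _] := gram i.
have := addr_gt0 (addr_gt0 si ti) (addr_gt0 si' ti').
rewrite !slope_refl2_sum ?n_norm ?n_next ?n_prev ?n_opp //; last 2 first.
- by rewrite g3 conjCK.
- by rewrite herm_sym g2.
have := b' i; rewrite !herm_refl !n_norm n_opp on !conjE.
set x := herm z (n i); set y := herm z (n (i + 2)).
rewrite (_ : _ + _ = x * y^* + x^* * y); last by ring.
move=> xy; rewrite (_ : _ + _ = - (2 * ((u ^+ 2 + u^* ^+ 2) * (x * y^* + x^* * y)))).
  rewrite oppr_gt0 => /(lt_trans (mulr_gt0 (ltr0n C 2) (mulr_gt0 u2 xy))).
  by rewrite ltxx.
by ring.
Qed.

Lemma base_region_scale c z : c != 0 -> base_region z -> base_region (c *: z).
Proof.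
move=> c0 [b b']; have cc : 0 < c * c^* by rewrite mul_conjC_gt0.
have slopeZ m m' : slope (c *: z) m m' = c * c^* * slope z m m'.
  by rewrite /slope !hermZl !conjE; ring.
split=> i; first by rewrite !slopeZ !(pmulr_rgt0 _ cc); exact: b.
rewrite !hermZl !conjE.
rewrite (_ : _ + _ = c * c^* * (herm z (n i) * (herm z (n (i + 2)))^*
  + (herm z (n i))^* * herm z (n (i + 2)))); first by rewrite (pmulr_rgt0 _ cc).
by ring.
Qed.

End PingPong.

End Lorentz.

(** * The signature of the form and the topology of U(3,1) *)

Section Signature.
Variable R : realType.
Local Notation C := R[i].
Implicit Types m z : 'cV[C]_4.

(** Let (a, b, c, d) and (x, y, v, t) be the coordinates of m and z.  If <z, m> = 0
    then conj d t = conj a x + conj b y + conj c v.  The Cauchy-Schwarz inequality, in the form of the identity of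
    Lagrange, bounds |d t|^2 by (|a|^2 + |b|^2 + |c|^2) (|x|^2 + |y|^2 + |v|^2), and
    the first factor is at most |d|^2. *)
Lemma herm_orth_ge0 m z :
  m != 0 -> herm m m <= 0 -> herm z m = 0 -> 0 <= herm z z.
Proof.
move=> m0; rewrite !hermE.
set a := m 0 0; set b := m 1 0; set c := m 2 0; set d := m 3 0.
set x := z 0 0; set y := z 1 0; set v := z 2 0; set t := z 3 0.
have nC (s : C) : s^* * s = `|s| ^+ 2 by rewrite mulrC normCK.
move=> mm zm.
have d0 : 0 < d^* * d.
  rewrite nC exprn_gt0 // normr_gt0; apply: contra m0 => /eqP d0.
  move: mm; rewrite d0 mulr0 subr0 !nC => s0.
  have /eqP : `|a| ^+ 2 + `|b| ^+ 2 + `|c| ^+ 2 = 0.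
    by apply/le_anti; rewrite s0 !addr_ge0 ?exprn_ge0.
  rewrite !paddr_eq0 ?addr_ge0 ?exprn_ge0 // !sqrf_eq0 !normr_eq0.
  move=> /andP[/andP[/eqP a0 /eqP b0] /eqP c0].
  apply/eqP/matrixP => i j; rewrite (ord1 j) mxE.
  by case: i => -[|[|[|[|//]]]] ?; [rewrite -a0|rewrite -b0|rewrite -c0|rewrite -d0];
    congr (m _ _); apply/val_inj.
rewrite -(pmulr_rge0 _ d0).
set N := a^* * a + b^* * b + c^* * c; set S := x^* * x + y^* * y + v^* * v.
have e : d^* * t = a^* * x + b^* * y + c^* * v by apply/esym/subr0_eq.
have e' : t^* * d = x^* * a + y^* * b + v^* * c.
  by move: (congr1 Num.conj e); rewrite !conjE mulrC => ->; ring.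
have lagrange : S * N - (d^* * t) * (t^* * d) =
    `|x * b - y * a| ^+ 2 + `|x * c - v * a| ^+ 2 + `|y * c - v * b| ^+ 2.
  by rewrite e e' !normCK !conjE /S /N; ring.
have -> : d^* * d * (S - t^* * t) = S * (d^* * d - N) + (S * N - (d^* * t) * (t^* * d)).
  ring.
rewrite lagrange addr_ge0 //; last by rewrite !addr_ge0 ?exprn_ge0.
apply: mulr_ge0; first by rewrite /S !nC !addr_ge0 ?exprn_ge0.
by rewrite subr_ge0 -subr_le0 /N.
Qed.

End Signature.

Section Topology.
Variable R : realType.
Local Notation C := R[i].

Lemma open_Re_gt0 : open [set x : C^o | 0 < complex.Re x].
Proof.
rewrite openE => x /= x0; apply/nbhs_ballP; exists (complex.Re x)%:C%C => /=.
  by rewrite ltcR.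
move=> y xy; have : `|complex.Re (x - y)| < complex.Re x.
  by rewrite -ltcR; apply: le_lt_trans (normc_ge_Re _) xy.
rewrite raddfB /=; move/(le_lt_trans (ler_norm _)); lra.
Qed.

Lemma conj_continuous : continuous (fun x : C^o => x^* : C^o).
Proof.
move=> x s /= /nbhs_ballP[e e0 es]; apply/nbhs_ballP; exists e => // y xy.
apply: es; suff : `|(x - y)^*| < e by rewrite rmorphB.
by rewrite norm_conjC.
Qed.

Lemma entry_continuous (i j : 'I_4) : continuous (fun A : U31 R => u31_mx A i j : C^o).
Proof.
move=> A; apply: (@continuous_comp _ _ _ (@u31_mx R) (fun M : 'M[C^o]_4 => M i j : C^o)).
  exact: initial_continuous.
exact: coord_continuous.
Qed.

Implicit Types f g : U31 R -> C^o.

Lemma continuous_addC f g : continuous f -> continuous g ->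
  continuous (fun A => f A + g A : C^o).
Proof. by move=> cf cg A; exact: (@continuousD C C^o _ _ _ A (cf A) (cg A)). Qed.

Lemma continuous_mulC f g : continuous f -> continuous g ->
  continuous (fun A => f A * g A : C^o).
Proof. by move=> cf cg A; exact: (@continuousM C _ f g A (cf A) (cg A)). Qed.

Lemma continuous_conjC f : continuous f -> continuous (fun A => (f A)^* : C^o).
Proof.
by move=> cf A; apply: (continuous_comp (cf A)); exact: conj_continuous.
Qed.

Lemma continuous_cstC (c : C) : continuous (fun _ : U31 R => c : C^o).
Proof. by move=> A; exact: cst_continuous. Qed.

Lemma herm_continuous (B : 'M[C]_4) (k : 'I_4) (w : 'cV[C]_4) :
  continuous (fun A : U31 R => herm (B *m u31_mx A *m delta_mx k 0) w : C^o).
Proof.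
have e A : herm (B *m u31_mx A *m delta_mx k 0) w =
    \sum_j (adj w *m Hmx R *m B) 0 j * u31_mx A j k.
  by rewrite /herm !mulmxA -colE !mxE.
have c (j : 'I_4) : continuous
    (fun A : U31 R => (adj w *m Hmx R *m B) 0 j * u31_mx A j k : C^o).
  apply: continuous_mulC; first exact: continuous_cstC.
  exact: entry_continuous.
under eq_fun do rewrite e !big_ord_recl big_ord0.
by do ![apply: continuous_addC => //]; exact: continuous_cstC.
Qed.

Lemma slope_continuous (B : 'M[C]_4) (k : 'I_4) (n m : 'cV[C]_4) :
  continuous (fun A : U31 R => slope (@herm R) (B *m u31_mx A *m delta_mx k 0) n m : C^o).
Proof.
by apply: continuous_addC; apply: continuous_mulC;
  do ?apply: continuous_conjC; exact: herm_continuous.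
Qed.

(** The positive reals are not open in C, but a real-valued function is positive
    exactly where its real part is, and this is an open condition. *)
Lemma nbhs_gt0C f A : continuous f -> (forall B, (f B)^* = f B) -> 0 < (f A : C) ->
  \forall B \near A, 0 < (f B : C).
Proof.
move=> cf real fA.
have gt0E B : (0 < (f B : C)) = (0 < complex.Re (f B)).
  have : complex.Im (conjc (f B)) = complex.Im (f B) by congr complex.Im; exact: real.
  rewrite ltcE /=; case: (f B) => x y /= xy.
  by have -> : y = 0 by [lra]; rewrite eqxx.
have : nbhs A (f @^-1` [set x : C^o | 0 < complex.Re x]).
  apply: cf; apply: open_nbhs_nbhs; split; first exact: open_Re_gt0.
  by rewrite /= -gt0E.
by apply: filterS => B /=; rewrite gt0E.
Qed.

Lemma base_region_near (n : 'I_4 -> 'cV[C]_4) (B : 'M[C]_4) (k : 'I_4) (A : U31 R) :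
  base_region (@herm R) n (B *m A *m delta_mx k 0) ->
  \forall A' \near A, base_region (@herm R) n (B *m u31_mx A' *m delta_mx k 0).
Proof.
move=> [sA rA].
have slope_near i j : 0 < slope (@herm R) (B *m A *m delta_mx k 0) (n i) (n j) ->
    \forall A' \near A, 0 < slope (@herm R) (B *m u31_mx A' *m delta_mx k 0) (n i) (n j).
  apply: nbhs_gt0C; first exact: slope_continuous.
  by move=> A'; exact: conj_cross.
pose h (A' : U31 R) i := herm (B *m u31_mx A' *m delta_mx k 0) (n i).
pose sl (j i : 'I_4) (A' : U31 R) :=
  0 < slope (@herm R) (B *m u31_mx A' *m delta_mx k 0) (n i) (n (i + j)).
have near1 : \forall A' \near A, forall i, sl 1 i A'.
  apply: (@filter_forall _ _ (sl 1) (nbhs A)) => i.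
  by apply: slope_near; have [] := sA i.
have near2 : \forall A' \near A, forall i, sl (- 1) i A'.
  apply: (@filter_forall _ _ (sl (- 1)) (nbhs A)) => i.
  by apply: slope_near; have [] := sA i.
pose q (i : 'I_4) (A' : U31 R) :=
  0 < h A' i * (h A' (i + 2))^* + (h A' i)^* * h A' (i + 2).
have near3 : \forall A' \near A, forall i, q i A'.
  apply: (@filter_forall _ _ q (nbhs A)) => i.
  apply: nbhs_gt0C (rA i) => [|A']; last exact: conj_cross.
  by apply: continuous_addC; apply: continuous_mulC;
    do ?apply: continuous_conjC; exact: herm_continuous.
apply: filterS3 near1 near2 near3 => A' h1 h2 h3.
split; first by move=> i; split; [exact: h1|exact: h2].
exact: h3.
Qed.

End Topology.

(** * The vectors n_i *)

Section Configuration.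
Variables (R : realType) (theta : R) (theta_itv : 5 * pi / 6 <= theta <= pi).
Local Notation C := R[i].

Definition unit_angle : C := (cos theta +i* sin theta)%C.
Local Notation u := unit_angle.

Lemma unit_angle_norm : u * u^* = 1.
Proof.
have := cos2Dsin2 theta => e; apply/eqP; rewrite eq_complex /= -e.
by apply/andP; split; apply/eqP; ring.
Qed.

Lemma unit_angle_sqr : 0 < u ^+ 2 + u^* ^+ 2.
Proof.
have := cos_theta_le theta_itv; have := sin_theta_le theta_itv.
have := sin_theta_ge0 theta_itv; have := cos2Dsin2 theta => e s0 s1 c.
rewrite ltcE /=; apply/andP; split; first by apply/eqP; ring.
nra.
Qed.

Lemma cos_theta_lt : cos theta < - (1 / 2).
Proof.
have := cos_theta_le theta_itv; have := sin_theta_le theta_itv.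
have := sin_theta_ge0 theta_itv; have := cos2Dsin2 theta => e s0 s1 c.
nra.
Qed.

Lemma Jmx4 (z : 'cV[C]_4) : Jmx R *m (Jmx R *m (Jmx R *m (Jmx R *m z))) = z.
Proof.
apply/matrixP => k j; rewrite (ord1 j) !JmxE.
rewrite (_ : _ * _ = ([:: -1; 'i%C; - 'i%C; 1]`_k * [:: -1; 'i%C; - 'i%C; 1]`_k) ^+ 2
  * z k 0); last by ring.
case: k => -[|[|[|[|//]]]] p /=; rewrite ?mulrNN ?mul_ii ?mul1r ?sqrrN ?expr1n ?mul1r //.
Qed.

(** For i = 3 the successor is 0, and the relation is J^4 = 1. *)
Lemma nvecS (i : 'I_4) : nvec theta (i + 1) = Jmx R *m nvec theta i.
Proof.
rewrite /nvec; case: i => -[|[|[|[|//]]]] p /=.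
- by rewrite expr0 expr1 mul1mx.
- by rewrite mulmxA; congr (_ *m _).
- by rewrite mulmxA; congr (_ *m _).
- rewrite expr0 mul1mx -{1}[n1 theta]Jmx4; congr (_ *m _).
  by rewrite !mulmxA; congr (_ *m _); rewrite -mulmxA.
Qed.

Lemma herm_nvecD (i j : 'I_4) :
  herm (nvec theta i) (nvec theta (i + j)) = herm (nvec theta 0) (nvec theta j).
Proof.
rewrite -(natr_Zp i); elim: (nat_of_ord i) => [|k ih]; first by rewrite add0r.
by rewrite mulrSr addrAC !nvecS JmxP.
Qed.

Lemma herm_nvec_next (i : 'I_4) : herm (nvec theta i) (nvec theta (i + 1)) = u.
Proof.
rewrite herm_nvecD -[1](add0r 1) nvecS /nvec expr0 !mul1mx hermE !JmxE /= !conjE.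
have sw (a x y : C) : a * x * y = a * (x * y) by ring.
rewrite !sw !n1_sqr //= conjCi.
by apply/eqP; rewrite eq_complex /=; apply/andP; split; apply/eqP; field.
Qed.

Lemma herm_nvec_opp (i : 'I_4) : herm (nvec theta i) (nvec theta (i + 2)) = 0.
Proof. by rewrite herm_nvecD herm_sym nvec_orth02 // conjC0. Qed.

(** J fixes the centre, so the product does not depend on i. *)
Lemma herm_centre_nvec (i : 'I_4) :
  herm (delta_mx 3 0) (nvec theta i) = - (n1 theta 3 0).
Proof.
have n3 : nvec theta i 3 0 = n1 theta 3 0.
  rewrite /nvec; elim: (nat_of_ord i) => [|k ih]; first by rewrite expr0 mul1mx.
  by rewrite exprS -mulmxA JmxE ih /= mul1r.
rewrite hermE n3 !mxE /= !mulr0 mulr1 !add0r; congr (- _).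
exact: conjc_real.
Qed.

Lemma base_region_centre : base_region (@herm R) (nvec theta) (delta_mx 3 0).
Proof.
set a := real_complex R (Num.sqrt (- 1 - 2 * cos theta) / 2).
have aE : n1 theta 3 0 = a by rewrite mxE.
have ca : a^* = a by exact: conjc_real.
have a0 : 0 < a.
  have c := cos_theta_lt; rewrite /a ltcR divr_gt0 // sqrtr_gt0; lra.
have c1 : 0 < 2 - u - u^*.
  have c := cos_theta_lt; rewrite ltcE /=; apply/andP; split; first by apply/eqP; ring.
  lra.
have prev (i : 'I_4) : herm (nvec theta i) (nvec theta (i - 1)) = u^*.
  by rewrite herm_sym -{2}(subrK 1 i) herm_nvec_next.
split=> i; last by rewrite !herm_centre_nvec !aE !conjE ca !mulrNN addr_gt0 ?mulr_gt0.
have cc := mulr_gt0 (mulr_gt0 a0 a0) c1.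
split; rewrite (slopeE (@hermDl R) (@hermZl R) (@herm_sym R)) ?herm_nvec_next ?prev
  !herm_centre_nvec !aE !conjE ca (_ : _ - _ = a * a * (2 - u - u^*)) //; by ring.
Qed.

End Configuration.

(** * Alternating words in G *)

Lemma G_pi_mul (v w : word 'I_4) :
  (\pi_(pres_group G_rels) v * \pi_(pres_group G_rels) w)%g =
  \pi_(pres_group G_rels) (v ++ w).
Proof. exact: pres_mulE. Qed.

Lemma G_pi_rel r : r \in G_rels -> \pi_(pres_group G_rels) r = 1%g.
Proof.
move=> rG; apply/pres_piP.
by have := pres_eq_rel [::] [::] rG; rewrite /= cats0.
Qed.

Lemma iota_sqr (i : 'I_4) : (iota_ i * iota_ i)%g = 1%g.
Proof.
rewrite /iota_ G_pi_mul; apply: G_pi_rel.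
by case: i => -[|[|[|[|//]]]].
Qed.

Lemma iota_opp (i : 'I_4) : (iota_ i * iota_ (i + 2) = iota_ (i + 2) * iota_ i)%g.
Proof.
have low (j : 'I_4) : (j < 2)%N -> (iota_ j * iota_ (j + 2) = iota_ (j + 2) * iota_ j)%g.
  move=> j2; apply: (mulgI (iota_ j * iota_ (j + 2))%g).
  have -> : (iota_ j * iota_ (j + 2) * (iota_ (j + 2) * iota_ j) = 1)%g.
    by rewrite mulgA -(mulgA (iota_ j)) iota_sqr mulg1 iota_sqr.
  rewrite /iota_ /pres_gen (G_pi_mul [:: _] [:: _]) (G_pi_mul [:: _; _] [:: _; _]).
  apply: G_pi_rel.
  by case: j j2 => -[|[|[|[|]]]] p q.
have [/low//|i2] := ltnP i 2.
by rewrite -{1 4}(ord4_addr4 i) low //; case: i i2 => -[|[|[|[|]]]].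
Qed.

Definition syllable (s : bool) (a : G) : Prop :=
  exists2 i : 'I_4, odd i = s & a = iota_ i \/ a = (iota_ i * iota_ (i + 2))%g.

(** Alternating products of syllables; the boolean is the parity of the leftmost
    one. *)
Inductive alternating : bool -> G -> Prop :=
| alternating_one s a : syllable s a -> alternating s a
| alternating_cons s a g :
    syllable s a -> alternating (~~ s) g -> alternating s (a * g)%g.

Lemma syllable_mul (x : 'I_4) a : syllable (odd x) a ->
  (iota_ x * a)%g = 1%g \/ syllable (odd x) (iota_ x * a)%g.
Proof.
move=> [i ix [->|->]]; have [->|->] := ord4_same_parity (esym ix).
- by left; exact: iota_sqr.
- by right; exists i; [rewrite ord4_odd_addr2|right; rewrite iota_opp].
- right; exists (i + 2); first by rewrite !ord4_odd_addr2.
  by left; rewrite mulgA iota_sqr mul1g.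
- right; exists i; first by rewrite ord4_odd_addr2.
  by left; rewrite mulgA -iota_opp -mulgA iota_sqr mulg1.
Qed.

Lemma alternating_mul (x : 'I_4) g : g = 1%g \/ (exists s, alternating s g) ->
  (iota_ x * g)%g = 1%g \/ exists s, alternating s (iota_ x * g)%g.
Proof.
have sx : syllable (odd x) (iota_ x) by exists x; [|left].
move=> [->|[s gs]].
  by right; exists (odd x); rewrite mulg1; apply: alternating_one.
have [sE|/negPf sE] := boolP (s == odd x); last first.
  right; exists (odd x); apply: alternating_cons => //.
  by move: gs; rewrite (_ : s = ~~ odd x) //; case: (s) (odd x) sE => -[].
case: gs (eqP sE) => {s sE} [s a|s a h] sa.
  move=> e; move: sa; rewrite e => /syllable_mul[]; first by left.
  by right; exists (odd x); exact: alternating_one.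
move=> hs e; subst s; rewrite mulgA; have [->|sxa] := syllable_mul sa.
  by right; exists (~~ odd x); rewrite mul1g.
by right; exists (odd x); exact: alternating_cons.
Qed.

Lemma alternatingP (g : G) : g = 1%g \/ exists s, alternating s g.
Proof.
elim/quotW: g => w; elim: w => [|[x b] w ih]; first by left.
have -> : \pi_(pres_group G_rels) ((x, b) :: w) = (iota_ x * \pi_(pres_group G_rels) w)%g.
  have -> : \pi_(pres_group G_rels) ((x, b) :: w) =
      (\pi_(pres_group G_rels) [:: (x, b)] * \pi_(pres_group G_rels) w)%g.
    by rewrite (G_pi_mul [:: _]).
  congr (_ * _)%g; case: b => //; apply: (mulgI (iota_ x)); rewrite iota_sqr.
  rewrite -[RHS](mulgV (iota_ x)); congr (_ * _)%g.
  by rewrite [RHS](pres_invE _ [:: (x, true)]).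
exact: alternating_mul.
Qed.

(** * Ping-pong on the centre, faithfulness and discreteness *)

Section Faithful.
Variables (R : realType) (theta : R) (theta_itv : 5 * pi / 6 <= theta <= pi).
Local Notation C := R[i].
Local Notation n := (nvec theta).
Local Notation p0 := (delta_mx 3 0 : 'cV[C]_4).
Local Notation dom := (domain (@herm R) n).
Local Notation base := (base_region (@herm R) n).

Let reflE m z : reflection (@herm R) m z = refl_mx m *m z.
Proof. by rewrite refl_mxE. Qed.

Let dom_refl (i : 'I_4) z : dom (odd i) z -> dom (~~ odd i) (refl_mx (n i) *m z).
Proof.
rewrite -reflE; apply: (domain_refl (@hermDl R) (@hermZl R) (@herm_sym R)
  (@herm_orth_ge0 R) (unit_angle_norm theta) (nvec_norm theta_itv)
  (herm_nvec_next theta_itv) (herm_nvec_opp theta_itv)).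
Qed.

Let dom_refl2 (i : 'I_4) z : dom (odd i) z ->
  dom (~~ odd i) (refl_mx (n i) *m (refl_mx (n (i + 2)) *m z)).
Proof.
rewrite -!reflE; apply: (domain_refl2 (@hermDl R) (@hermZl R) (@herm_sym R)
  (@herm_orth_ge0 R) (unit_angle_norm theta) (nvec_norm theta_itv)
  (herm_nvec_next theta_itv) (herm_nvec_opp theta_itv)).
Qed.

(** The image of the ping-pong domain of one subgroup under its own nontrivial
    elements. *)
Definition moved (s : bool) (z : 'cV[C]_4) : Prop :=
  exists2 i : 'I_4, odd i = s & exists2 y, dom s y &
    z = refl_mx (n i) *m y \/ z = refl_mx (n i) *m (refl_mx (n (i + 2)) *m y).

Lemma moved_domain s z : moved s z -> dom (~~ s) z.
Proof. by move=> [i <- [y yD [->|->]]]; [exact: dom_refl|exact: dom_refl2]. Qed.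

Lemma moved_base s z : moved s z -> ~ base z.
Proof.
move=> [i <- [y yD [->|->]]]; rewrite -!reflE.
  exact: (base_region_refl (@hermDl R) (@hermZl R) (@herm_sym R)
    (unit_angle_norm theta) (nvec_norm theta_itv) (herm_nvec_next theta_itv)).
exact: (base_region_refl2 (@hermDl R) (@hermZl R) (@herm_sym R)
    (unit_angle_norm theta) (unit_angle_sqr theta_itv) (nvec_norm theta_itv)
    (herm_nvec_next theta_itv) (herm_nvec_opp theta_itv)).
Qed.

Lemma centre_domain s : dom s p0.
Proof.
split=> [|i _]; last by have [b _] := base_region_centre theta_itv; exact: b.
by rewrite hermE !mxE /= !mulr0 mulr1 !add0r conjC1 oppr_lt0.
Qed.

(** The ping-pong: the leftmost syllable is applied to a point of its own domain,
    either the centre or a point moved there by the rest of the word. *)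
Lemma alternating_moved s g : alternating s g ->
  exists2 A : U31 R, rho theta_itv g = \pi_(PU31 R) A & moved s (A *m p0).
Proof.
have piM A B : (\pi_(PU31 R) A * \pi_(PU31 R) B)%g = \pi_(PU31 R) (A * B)%g.
  exact: PU31_mulE.
have syl s' a z : syllable s' a -> dom s' z ->
    exists2 A : U31 R, rho theta_itv a = \pi_(PU31 R) A & moved s' (A *m z).
  move=> [i <- [->|->]] zD.
    exists (I_U31 theta_itv i); first exact: rho_iota.
    by exists i => //; exists z => //; left.
  exists (I_U31 theta_itv i * I_U31 theta_itv (i + 2))%g.
    by rewrite gmulfM !rho_iota (piM (I_U31 theta_itv i)).
  by exists i => //; exists z => //; right; rewrite mulmxA.
elim=> {s g} [s a sa|s a g sa _ [A gA Ap]].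
  exact: syl sa (centre_domain s).
have [B aB Bp] := syl _ _ _ sa (eq_rect _ (fun b => dom b _) (moved_domain Ap) _ (negbK s)).
exists (B * A)%g; first by rewrite gmulfM aB gA (piM B).
by rewrite -mulmxA.
Qed.

Lemma nontrivial_moved g : g <> 1%g ->
  exists2 A : U31 R, rho theta_itv g = \pi_(PU31 R) A & ~ base (A *m p0).
Proof.
move=> g1; have [//|[s /alternating_moved[A gA Ap]]] := alternatingP g.
by exists A => //; exact: moved_base Ap.
Qed.

Lemma base_scale (c : C) z : c != 0 -> base z -> base (c *: z).
Proof. exact: (base_region_scale (@hermZl R)). Qed.

End Faithful.

Lemma quotient_open_preimage (T : topologicalType) (Q : quotType T)
    (U : set (quotient_topology Q)) :
  open (\pi_(quotient_topology Q) @^-1` U) -> open U.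
Proof. by []. Qed.

Theorem theorem1p1 (R : realType) (theta : R)
    (theta_itv : 5 * pi / 6 <= theta <= pi) :
  injective (rho theta_itv) /\ discrete_set (range (rho theta_itv)).
Proof.
pose p0 : 'cV[R[i]]_4 := delta_mx 3 0.
pose base := base_region (@herm R) (nvec theta).
have bp0 : base p0 by exact: base_region_centre.
have trivial g (A : U31 R) : rho theta_itv g = \pi_(PU31 R) A -> base (A *m p0) -> g = 1%g.
  move=> gA Ab; apply: contrapT => /(nontrivial_moved theta_itv)[B gB]; apply.
  have /PU31_piP[c Bc] : \pi_(PU31 R) B = \pi_(PU31 R) A by rewrite -gB.
  rewrite Bc mul_scalar_mx -scalemxAl; apply: base_scale => //.
  apply/eqP => c0; have := U31_neq0 B.
  by rewrite Bc c0 mul_scalar_mx scale0r eqxx.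
have rho1 : rho theta_itv 1%g = 1%g.
  by apply: (mulgI (rho theta_itv 1%g)); rewrite -gmulfM !mulg1.
have rhoV g : rho theta_itv (g^-1)%g = ((rho theta_itv g)^-1)%g.
  by apply: (mulgI (rho theta_itv g)); rewrite -gmulfM !mulgV.
split=> [g h gh|_ [g _ <-]].
  suff e : (g^-1 * h)%g = 1%g by apply: (mulgI g^-1%g); rewrite e mulVg.
  apply: (@trivial _ 1%g); last by rewrite /= mul1mx.
  by rewrite gmulfM -gh rhoV mulVg.
split; first by apply/mem_set; exists g.
pose A := repr (rho theta_itv g).
(* A translate by rho g of the elements that keep p0 in the base region; the
   condition is invariant under scalars, so any lift can be used. *)
pose V := [set P : PU31 R | base ((A^-1 * repr P)%g *m p0)].
have VE B : V (\pi_(PU31 R) B) <-> base ((A^-1 * B)%g *m p0).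
  have [c Bc] := PU31_repr B.
  have c0 : c != 0.
    apply/eqP => c0; have := U31_neq0 (repr (\pi_(PU31 R) B)).
    by rewrite Bc c0 mul_scalar_mx scale0r eqxx.
  have -> : V (\pi_(PU31 R) B) = base (c *: ((A^-1 * B)%g *m p0)).
    rewrite /V /=; congr base.
    by rewrite Bc mul_scalar_mx -scalemxAr -scalemxAl.
  split; last exact: base_scale.
  by move/(base_scale (invr_neq0 c0)); rewrite scalerA mulVf // scale1r.
have oV : open V.
  apply: (@quotient_open_preimage _ {eq_quot (scal_equiv R)}).
  rewrite openE => B VB.
  have bB : base (u31_mx (A^-1)%g *m u31_mx B *m p0) by exact: (proj1 (VE B)).
  by apply: filterS (base_region_near bB) => B' b'; exact: (proj2 (VE B')).
exists V.
  apply: open_nbhs_nbhs; split=> //.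
  by rewrite -[rho theta_itv g]reprK VE mulVg /= mul1mx.
apply/seteqP; split=> [P [VP [h _ hP]]|_ ->]; last first.
  split; last by exists g.
  by rewrite -[rho theta_itv g]reprK; apply/VE; rewrite mulVg /= mul1mx.
rewrite /= -hP in VP *.
suff e : (g^-1 * h)%g = 1%g.
  by congr (rho theta_itv _); apply: (mulgI g^-1%g); rewrite e mulVg.
apply: trivial VP; rewrite gmulfM rhoV -{1}[rho theta_itv g]reprK.
rewrite -{1}[rho theta_itv h]reprK [(_ ^-1)%g]PU31_invE; exact: PU31_mulE.
Qed.
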